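(* Let $k,r,n,m$ be positive integers with $r\geq 2$ and $k\geq 1$. Let $\pi=(P_1,P_2,\ldots,P_m)$ be a partition of $[n]$ and let $\vec{s}=(s_1,s_2,\ldots,s_m)$ be a vector of positive integers such that $s_i\le |P_i|\leq 2s_i$ for each $1\le i\le m$ and $k\leq \sum_{i=1}^m s_i$. Then $$\chi(\mathrm{KG}^r(\pi;\vec{s};k))=\left\lceil\frac{n-r(k-1)}{r-1}\right\rceil.$$
   Context: $[n]=\{1,\ldots,n\}$. The multiple Kneser hypergraph $\mathrm{KG}^r(\pi;\vec{s};k)$ has as vertices all sets $A\subseteq P_1\cup\cdots\cup P_m$ with $|A|=k$ and $|A\cap P_i|\le s_i$ for all $1\le i\le m$; its edges are all $r$-element collections $\{A_1,\ldots,A_r\}$ of pairwise disjoint vertices. The chromatic number $\chi$ of a hypergraph is the least number $t$ such that its vertices can be colored with $t$ colors so that no edge is monochromatic.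
   Formalization: The formal theorem adds the hypothesis n > r(k-1); without it the claim is always false, since a vertex exists (so the chromatic number is at least 1) while the right-hand side is at most 0, e.g. m=1, n=k=r=2, s_1=2 gives 1 versus 0. *)

(* Defs.v *)
From mathcomp Require Import all_boot all_order all_algebra.

Set Implicit Arguments.
Unset Strict Implicit.
Unset Printing Implicit Defensive.

Record hypergraph := Hypergraph {
  vertex : finType;
  edges : {set {set vertex}}
}.

Definition monochromatic (V : finType) (t : nat) (c : {ffun V -> 'I_t})
    (e : {set V}) : bool :=
  [forall u in e, forall v in e, c u == c v].

Definition colorable (H : hypergraph) (t : nat) : bool :=
  [exists c : {ffun vertex H -> 'I_t},
     [forall e in edges H, ~~ monochromatic c e]].

(* The search may stop at the number of vertices: see chromatic_numberP.  If H
   is not colorable at all (it has an edge with at most one vertex), the value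
   is the junk value #|vertex H|.+1. *)
Definition chromatic_number (H : hypergraph) : nat :=
  find (colorable H) (iota 0 #|vertex H|.+1).

Lemma colorable_card (H : hypergraph) (t : nat) :
  colorable H t -> colorable H #|vertex H|.
Proof.
case/existsP=> c /forall_inP cP; apply/existsP; exists [ffun v => enum_rank v].
apply/forall_inP=> e /cP; apply: contra => /forall_inP me.
apply/forall_inP=> u ue; apply/forall_inP=> v ve.
have /forall_inP/(_ v ve) := me u ue.
by rewrite !ffunE => /eqP/enum_rank_inj->.
Qed.

Lemma chromatic_numberP (H : hypergraph) (t0 : nat) :
  colorable H t0 ->
  colorable H (chromatic_number H) /\
  (forall t, colorable H t -> chromatic_number H <= t).
Proof.
move=> /colorable_card Ht0; rewrite /chromatic_number.
set s := iota _ _.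
have hs : has (colorable H) s.
  by apply/hasP; exists #|vertex H|; rewrite ?mem_iota //= add0n ltnS.
have lt_find : find (colorable H) s < #|vertex H|.+1.
  by move: hs; rewrite has_find size_iota.
split; first by have := nth_find 0 hs; rewrite nth_iota.
move=> t Ht; rewrite leqNgt; apply/negP => lt_t.
have := before_find 0 lt_t.
by rewrite nth_iota ?add0n ?Ht // (ltn_trans lt_t).
Qed.

(* [n] is 'I_n, i.e. {0, ..., n-1}.  Injectivity says that the parts P i are
   listed without repetition. *)
Definition ordered_partition (n m : nat) (P : 'I_m -> {set 'I_n}) : bool :=
  injectiveb P && partition [set P i | i : 'I_m] [set: 'I_n].

Section MultipleKneser.

Variables (n m : nat) (r : nat) (P : 'I_m -> {set 'I_n}) (s : 'I_m -> nat).
Variable k : nat.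

Definition kneser_vertex_pred (A : {set 'I_n}) : bool :=
  [&& A \subset \bigcup_(i < m) P i,
      #|A| == k
    & [forall i : 'I_m, #|A :&: P i| <= s i]].

Definition kneser_vertex : finType := {A : {set 'I_n} | kneser_vertex_pred A}.

Definition kneser_edges : {set {set kneser_vertex}} :=
  [set E : {set kneser_vertex} |
    (#|E| == r) && trivIset [set val A | A in E]].

Definition KG : hypergraph := Hypergraph kneser_edges.

End MultipleKneser.

(* Main.v *)
Require Import Defs.
From mathcomp Require Import all_boot all_order all_algebra.
From mathcomp Require Import zify ring lra.
Import Order.TTheory GRing.Theory Num.Theory.
Set Implicit Arguments.
Unset Strict Implicit.
Unset Printing Implicit Defensive.
Local Open Scope ring_scope.

(** The upper bound is elementary: with [t] colours, cut an initial part of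
    the ground set into [t - 1] blocks of [r - 1] elements; a vertex meeting
    one of them takes the colour of such a block, the others take the last
    colour. Pairwise disjoint vertices of a block colour number at most
    [r - 1], and the vertices of the last colour live on fewer than [r * k]
    elements ([KG_colorable]).

    The lower bound is a statement about an arbitrary colouring of the
    admissible [k]-subsets of an arbitrary subset [N] of the ground set: a
    large [N] contains [r] pairwise disjoint admissible sets of one colour
    ([mono_family_ord]). In this relative form it is multiplicative in [r]. If
    [r = a * b], colour each subset of [N] of the size required for [a] by the
    common colour of an [a]-family inside it; the case [b], with a single
    block that constrains nothing, yields [b] disjoint subsets with the same
    colour, and their [a]-families together form the family wanted. So [r = p]
    may be assumed prime.

    For prime [p], the argument is topological. Call signed vector a list of
    distinct elements of [N], in the order of the blocks, each with a sign in
    Z/p; signed vectors are ordered by inclusion, and Z/p acts by shifting all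
    signs. The key fact ([alternating_flag]) is that for every equivariant map
    [e] from nonzero signed vectors to Z/p there is a maximal flag X_1 < ... <
    X_n, where n = |N|, on which consecutive values of [e] differ. It is
    Dold's theorem for this poset, proved with explicit cochains. On one side
    there are chains c_1, c_2, ... whose boundaries are, alternately, the
    images of the previous chain under the generator minus one and under the
    norm of the group ring; here they appear through the functional [pairing],
    and the boundary relation is [pairing_coboundary]. On the other side are
    the standard cocycles of Z/p, products of carries, pulled back along [e].
    Pairing the two gives 1 in every dimension ([pairing_cocycle]), whereas
    the cocycles vanish as soon as two consecutive signs agree.

    Suppose now that there is no monochromatic family. For a colour [c] and a
    signed vector [X], the signs whose class in [X] contains an admissible set
    coloured [c] form a proper subset of Z/p, the [fibre]. If all the fibres
    are empty, then the sign sequence of [X] has at most p(k-1) runs: with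
    more runs, some sign starts [k] of them, and [k] starting points never
    contain two consecutive elements, hence meet a block of at most 2 s_i
    elements in at most s_i ([runs_bound]). Let the [rank] of [X] be its
    number of runs if all fibres are empty, and p(k-1) plus the total size of
    the fibres otherwise. Let the [sign] of [X] be its first sign in the
    former case, and the average of a nonempty fibre in the latter; averages
    exist as the size of the fibre is invertible modulo [p]. The rank is
    monotone, and the sign can only change where the rank grows
    ([rank_subseq]). On the flag above the rank would thus reach [n], but it
    is at most p(k-1) + t(p-1). *)

(** * Cochains on sequences of vertices *)

Section Cochains.
Variable R : comNzRingType.

(** A cochain is a function on all finite sequences of vertices. The sequence
    of length [d] plays the part of a simplex of dimension [d - 1], so that
    the complex is augmented by the empty sequence. *)
Fixpoint coboundary (T : Type) (f : seq T -> R) (xs : seq T) : R :=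
  if xs is x :: xs' then f xs' - coboundary (fun zs => f (x :: zs)) xs' else 0.

Lemma coboundaryB (T : Type) (f g : seq T -> R) xs :
  coboundary (fun zs => f zs - g zs) xs = coboundary f xs - coboundary g xs.
Proof. by elim: xs f g => [|x xs IH] f g /=; rewrite ?IH; ring. Qed.

Lemma coboundaryZ (T : Type) (a : R) (f : seq T -> R) xs :
  coboundary (fun zs => a * f zs) xs = a * coboundary f xs.
Proof. by elim: xs f => [|x xs IH] f /=; rewrite ?IH; ring. Qed.

Lemma coboundary_sum (T : Type) (I : finType) (f : I -> seq T -> R) xs :
  coboundary (fun zs => \sum_i f i zs) xs = \sum_i coboundary (f i) xs.
Proof.
elim: xs f => [|x xs IH] f /=; first by rewrite big1.
by rewrite IH -sumrB.
Qed.

Lemma coboundary_map (T U : Type) (h : T -> U) (f : seq U -> R) xs :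
  coboundary (fun zs => f (map h zs)) xs = coboundary f (map h xs).
Proof. by elim: xs f => [|x xs IH] f //=; rewrite -IH. Qed.

Section Prism.
Variables (T : Type) (j : T -> T).

(** Evaluation of [f] on the prism between a simplex [xs] and its image under
    [j], cut into simplices and completed by the cone with apex [j y]; in the
    recursive call [y] is the vertex that precedes [xs]. *)
Fixpoint prism (y : T) (f : seq T -> R) (xs : seq T) : R :=
  f (j y :: map j xs) -
  (if xs is x :: xs' then prism x (fun zs => f (x :: zs)) xs' else 0).

Lemma prismB y f g xs :
  prism y (fun zs => f zs - g zs) xs = prism y f xs - prism y g xs.
Proof. by elim: xs y f g => [|x xs IH] y f g /=; rewrite ?IH; ring. Qed.

(** The prism joins [xs] to its image under [j], and the cone fills the
    latter: in the augmented complex nothing else is left of the boundary. *)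
Lemma prism_homotopy y f xs :
  prism y (coboundary f) xs = f xs - coboundary (prism y f) xs.
Proof.
elim: xs y f => [|x xs IH] y f; first by rewrite /=; ring.
have -> : coboundary (prism y f) (x :: xs) =
  prism y f xs - (coboundary (fun zs => f [:: j y, j x & zs]) (map j xs)
     - coboundary (prism x (fun zs => f (x :: zs))) xs).
  by rewrite -coboundary_map -coboundaryB.
have -> : prism y (coboundary f) (x :: xs) =
  coboundary f [:: j y, j x & map j xs]
  - (prism x f xs - prism x (coboundary (fun zs => f (x :: zs))) xs).
  by rewrite -prismB.
rewrite IH; case: xs {IH} => [|z xs] /=; ring.
Qed.

End Prism.
End Cochains.

(** * Signed vectors and the chains of the minimal resolution *)

Section SignedVectors.
Variables (q : nat) (E : eqType).
Notation G := 'I_q.+2.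
Notation signed := (seq (E * G)).

Definition rotate (a : G) (X : signed) : signed :=
  [seq (x.1, x.2 + a) | x <- X].

Lemma rotateD a b X : rotate a (rotate b X) = rotate (b + a) X.
Proof. by rewrite /rotate -map_comp; apply: eq_map => x /=; rewrite addrA. Qed.

Definition extend (v : E) (X : signed) : signed := (v, 0) :: X.

(** The maps of the periodic resolution of a cyclic group: alternately the
    generator minus one and the norm. The first chain is the cone over the
    empty simplex itself, hence the identity in degree 0. *)
Definition wind (d : nat) (f : seq signed -> G) (xs : seq signed) : G :=
  if d is 0 then f xs
  else if odd d then f (map (rotate 1) xs) - f xs
  else \sum_(a : G) f (map (rotate a) xs).

(** [pairing u f] is the value of [f] on a chain with [size u] vertices, which
    is the cone, with apex the new element with sign 0, over the chain
    attached to the tail of [u], transformed by [wind]. Defining the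
    functional rather than the chain avoids formal sums. *)
Fixpoint pairing (u : seq E) (f : seq signed -> G) : G :=
  if u is v :: u' then pairing u' (wind (size u') (prism (extend v) [::] f))
  else f [::].

Definition supported (u : seq E) (X : signed) : bool :=
  (X != [::]) && subseq (map fst X) u.

(** The simplices on which the chains are supported. The path starts at the
    zero vector, which is the base point of [prism] in [pairing]. *)
Definition flag (u : seq E) (xs : seq signed) : bool :=
  [&& size xs == size u, path subseq [::] xs & all (supported u) xs].

Lemma supported_cons v u X : supported u X -> supported (v :: u) X.
Proof.
case/andP=> X0 s; rewrite /supported X0; apply: subseq_trans s _.
exact: subseq_cons.
Qed.

Lemma supported_rotate u a X : supported u (rotate a X) = supported u X.
Proof. by rewrite /supported /rotate -map_comp; case: X. Qed.

Lemma subseq_rotate a X Y : subseq X Y -> subseq (rotate a X) (rotate a Y).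
Proof. exact: map_subseq. Qed.

Lemma flag_rotate u a xs : flag u xs -> flag u (map (rotate a) xs).
Proof.
case/and3P=> s p g; apply/and3P; split; first by rewrite size_map.
- rewrite -[[::]]/(rotate a [::]) path_map.
  by apply: sub_path p => X Y; apply: subseq_rotate.
- by rewrite all_map; apply: sub_all g => X; rewrite /= supported_rotate.
Qed.

Lemma eq_prism v u (y : signed) (f g : seq signed -> G) xs :
    subseq (map fst y) u -> path subseq y xs -> all (supported u) xs ->
    (forall zs, size zs = (size xs).+1 -> path subseq y zs ->
       all (supported (v :: u)) zs -> f zs = g zs) ->
  prism (extend v) y f xs = prism (extend v) y g xs.
Proof.
have ext_sup X : subseq (map fst X) u -> supported (v :: u) (extend v X).
  by rewrite /supported /= eqxx.
have sup_ext X : supported u X -> supported (v :: u) (extend v X).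
  by case/andP => _; apply: ext_sup.
elim: xs y f g => [|x xs IH] y f g yu pxs gxs fg.
  rewrite /= fg //= ?ext_sup // andbT; exact: subseq_cons.
rewrite [LHS]/= [RHS]/=; congr (_ - _).
  apply: fg; rewrite /= ?size_map //.
    apply/andP; split; first exact: subseq_cons.
    have : path subseq (extend v y) (map (extend v) (x :: xs)).
      rewrite path_map; apply: sub_path pxs => X Y sXY.
      by rewrite /= eqxx.
    by [].
  rewrite ext_sup //= sup_ext ?all_map //=; last by case/andP: gxs.
  by case/andP: gxs => _; apply: sub_all => X; apply: sup_ext.
case/andP: pxs => yx pxs; case/andP: gxs => gx gxs.
apply: IH => //; first by case/andP: gx.
by move=> zs sz pz gz; apply: fg; rewrite /= ?sz ?yx ?supported_cons.
Qed.

(** A chain is a combination of flags: extending by a new element along a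
    prism keeps vectors increasing, and so does shifting the signs. *)
Lemma eq_pairing u f g :
  (forall xs, flag u xs -> f xs = g xs) -> pairing u f = pairing u g.
Proof.
elim: u f g => [|v u IH] f g fg /=; first exact: fg.
apply: IH => xs fxs.
have H zs : flag u zs ->
    prism (extend v) [::] f zs = prism (extend v) [::] g zs.
  case/and3P=> /eqP s p al; apply: (@eq_prism v u) => //; first exact: sub0seq.
  move=> ws sw pw aw; apply: fg; apply/and3P; split => //.
  by rewrite sw /= s.
rewrite /wind; case: (size u) => [|d]; first exact: H.
case: ifP => _; first by rewrite !H ?flag_rotate.
by apply: eq_bigr => a _; rewrite H ?flag_rotate.
Qed.

Lemma windB d f g xs :
  wind d (fun zs => f zs - g zs) xs = wind d f xs - wind d g xs.
Proof.
rewrite /wind; case: d => [|d] //; case: ifP => _; first by ring.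
by rewrite sumrB.
Qed.

Lemma pairingB u f g :
  pairing u (fun zs => f zs - g zs) = pairing u f - pairing u g.
Proof.
elim: u f g => [|v u IH] f g //=.
rewrite -IH; apply: eq_pairing => xs _; rewrite -windB.
rewrite /wind; case: (size u) => [|d]; rewrite ?prismB //; case: ifP => _ //.
by apply: eq_bigr => a _; rewrite prismB.
Qed.

Lemma pairing0 u : pairing u (fun=> 0) = 0.
Proof.
rewrite -[RHS](subrr (pairing u (fun=> 0))) -pairingB.
by apply: eq_pairing => xs _; rewrite subrr.
Qed.

Lemma wind_coboundary d f xs :
  wind d (coboundary f) xs = coboundary (wind d f) xs.
Proof.
rewrite /wind; case: d => [|d] //; case: ifP => _.
  by rewrite coboundaryB coboundary_map.
by rewrite coboundary_sum; apply: eq_bigr => a _; rewrite coboundary_map.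
Qed.

Lemma sum_rotate (f : seq signed -> G) (b : G) xs :
  \sum_(a : G) f (map (rotate (b + a)) xs) = \sum_(a : G) f (map (rotate a) xs).
Proof. by rewrite [RHS](reindex_inj (addrI b)). Qed.

(** In the group ring, the generator minus one and the norm have product 0. *)
Lemma wind_wind d (f : seq signed -> G) xs :
  (0 < d)%N -> wind d (wind d.+1 f) xs = 0.
Proof.
have mapD a b ys : map (rotate a) (map (rotate b) ys) = map (rotate (b + a)) ys.
  by rewrite -map_comp; apply: eq_map => X; rewrite /= rotateD.
case: d => // d _; rewrite /wind [odd d.+2]/= negbK [odd d.+1]/=.
case: (odd d) => /=.
  rewrite sumrB -(sum_rotate f 1 xs) -sumrB big1 // => a _.
  by rewrite mapD (addrC a) subrr.
apply/eqP; rewrite subr_eq0; apply/eqP; rewrite -(sum_rotate f 1 xs).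
by apply: eq_bigr => a _; rewrite mapD.
Qed.

(** The boundary of a cone over a cycle is this cycle. The base of the cone is
    a cycle by the same relation one dimension lower and [wind_wind]; the last
    case, where it is the difference of two points, is a cycle because the
    augmentation of this difference is 0. *)
Lemma pairing_coboundary v u f :
  pairing (v :: u) (coboundary f) = pairing u (wind (size u) f).
Proof.
elim: u v f => [|x u IH] v f; first by rewrite /= !subr0.
set w := x :: u.
have zero : pairing w
    (coboundary (wind (size w) (prism (extend v) [::] f))) = 0.
  rewrite IH; case: (posnP (size u)) => [u0|u_gt0].
    by rewrite [size w]/= u0 (size0nil u0) /= subrr.
  rewrite (eq_pairing (g := fun=> 0)) ?pairing0 // => xs _.
  exact: wind_wind.
rewrite -[RHS]subr0 -zero -pairingB.
rewrite -[LHS]/(pairing w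
  (wind (size w) (prism (extend v) [::] (coboundary f)))).
apply: eq_pairing => xs _; rewrite -wind_coboundary -windB.
rewrite /wind; case: (size w) => [|d]; first exact: prism_homotopy.
case: ifP => _; first by rewrite !prism_homotopy.
by apply: eq_bigr => a _; rewrite prism_homotopy.
Qed.
End SignedVectors.

(** * The standard cocycles of a cyclic group *)

Section Cocycles.
Variable q : nat.
Notation G := 'I_q.+2.

(** Going from [a] to [b] around the cycle by a nonnegative step passes
    through 0 exactly if [b < a] as numbers. *)
Definition wrap (a b : G) : G := (b < a)%N%:R.

(** The coboundary of [wrap]: the carry in the addition of the steps [b - a]
    and [c - b], the classical generator of the cohomology in degree 2. *)
Definition carry (a b c : G) : G := wrap b c - wrap a c + wrap a b.

(** The cup powers of [carry]. Consecutive factors share a vertex; on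
    sequences of even length, which have odd dimension, the value is 0. *)
Fixpoint even_cocycle (l : seq G) : G :=
  match l with
  | [::] => 0
  | a :: l1 => match l1 with
    | [::] => 1
    | b :: l2 => match l2 with
      | [::] => 0
      | c :: _ => carry a b c * even_cocycle l2
      end
    end
  end.

Definition odd_cocycle (l : seq G) : G :=
  if l is a :: l1 then
    if l1 is b :: _ then (b - a) * even_cocycle l1 else 0
  else 0.

Definition cocycle (l : seq G) : G :=
  if odd (size l) then even_cocycle l else odd_cocycle l.

(** Left cup products with two cochains that are not invariant under shifts:
    the identity in degree 0, and [wrap] in degree 1. The coboundaries of
    their products with [even_cocycle] are the invariant cocycles. *)
Definition cup0 (f : seq G -> G) (l : seq G) : G :=
  if l is a :: l1 then a * f l else 0.

Definition cup_wrap (f : seq G -> G) (l : seq G) : G :=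
  if l is a :: l1 then if l1 is b :: _ then wrap a b * f l1 else 0 else 0.

(** By the Leibniz rule for the first factor, since [carry] is closed. *)
Lemma even_cocycle_closed l : coboundary even_cocycle l = 0.
Proof.
have [n] := ubnP (size l); elim: n l => // n IH [|a [|b [|c [|d l]]]] szl;
  rewrite /= ?subr0 ?sub0r ?subrr ?oppr0 //.
have /eqP : coboundary even_cocycle [:: c, d & l] = 0.
  by apply: IH; move: szl => /=; lia.
rewrite -[coboundary _ _]/(even_cocycle (d :: l) -
  coboundary (fun zs => even_cocycle (c :: zs)) (d :: l)).
rewrite subr_eq0 => /eqP closed.
transitivity (carry b c d * even_cocycle (d :: l) -
  (carry a c d * even_cocycle (d :: l) -
  (carry a b d * even_cocycle (d :: l) -
    coboundary (fun zs => carry a b c * even_cocycle (c :: zs)) (d :: l)))).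
  by [].
rewrite coboundaryZ -closed /carry; ring.
Qed.

Lemma coboundary_cup0 l :
  ~~ odd (size l) -> coboundary (cup0 even_cocycle) l = odd_cocycle l.
Proof.
case: l => [|a [|b l]] // _.
have /eqP := even_cocycle_closed [:: a, b & l].
rewrite -[coboundary _ _]/(even_cocycle (b :: l) -
  coboundary (fun zs => even_cocycle (a :: zs)) (b :: l)).
rewrite subr_eq0 => /eqP closed.
transitivity (b * even_cocycle (b :: l) -
    coboundary (fun zs => a * even_cocycle (a :: zs)) (b :: l)).
  by [].
rewrite coboundaryZ -closed -[RHS]/((b - a) * even_cocycle (b :: l)); ring.
Qed.

Lemma coboundary_cup_wrap l :
  (2 < size l)%N -> coboundary (cup_wrap even_cocycle) l = even_cocycle l.
Proof.
case: l => [|a [|b [|c l]]] // _.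
have /eqP := even_cocycle_closed [:: b, c & l].
rewrite -[coboundary _ _]/(even_cocycle (c :: l) -
  coboundary (fun zs => even_cocycle (b :: zs)) (c :: l)).
rewrite subr_eq0 => /eqP closed.
transitivity (wrap b c * even_cocycle (c :: l) -
  (wrap a c * even_cocycle (c :: l) -
    coboundary (fun zs => wrap a b * even_cocycle (b :: zs)) (c :: l))).
  by [].
rewrite coboundaryZ -closed -[RHS]/(carry a b c * even_cocycle (c :: l)) /carry.
ring.
Qed.

Lemma val_addG (a b : G) :
  (a + b)%R = (a + b - (q.+2 <= a + b) * q.+2)%N :> nat.
Proof.
have := ltn_ord a; have := ltn_ord b.
rewrite /= => lb la; case: leqP => H; first by rewrite modn_small; lia.
by rewrite mul1n -{1}(subnK H) modnDr modn_small //; lia.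
Qed.

(** A shift changes [wrap] by the coboundary of [m], which tells the elements
    that the shift takes through 0; hence it does not change the coboundary of
    [wrap]. *)
Lemma carry_shift (s a b c : G) : carry (a + s) (b + s) (c + s) = carry a b c.
Proof.
pose m (x : G) : G := (q.+2 <= x + s)%N%:R.
have H x y : wrap (x + s) (y + s) = wrap x y + m y - m x.
  apply/eqP; rewrite eq_sym subr_eq eq_sym /wrap /m -!natrD; apply/eqP.
  congr (_%:R); rewrite !val_addG.
  have := ltn_ord x; have := ltn_ord y; have := ltn_ord s.
  case: (leqP _ (x + s)%N); case: (leqP _ (y + s)%N);
   case: (ltnP y x) => /=; case: ltnP => /=; lia.
rewrite /carry !H; ring.
Qed.

Lemma even_cocycle_shift (s : G) l :
  even_cocycle [seq x + s | x <- l] = even_cocycle l.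
Proof.
have [n] := ubnP (size l); elim: n l => // n IH [|a [|b [|c l]]] // szl.
have -> : even_cocycle [seq x + s | x <- [:: a, b, c & l]] =
  carry (a + s) (b + s) (c + s) * even_cocycle [seq x + s | x <- c :: l] by [].
by rewrite IH ?carry_shift //; move: szl => /=; lia.
Qed.

(** Over all the shifts, exactly [b - a] of the translates of the arc from [a]
    to [b] pass through 0. This links the norm of the degree 1 cochain [wrap]
    to the invariant cocycle [b - a]. *)
Lemma sum_wrap (a b : G) : \sum_(s : G) wrap (a + s) (b + s) = b - a.
Proof.
have -> : \sum_(s : G) wrap (a + s) (b + s) = \sum_(x : G) wrap x (x + (b - a)).
  rewrite [RHS](reindex_inj (addrI a)); apply: eq_bigr => s _.
  by congr wrap; ring.
move: (b - a) => c; rewrite -natr_sum.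
suff -> : (\sum_(x : G) ((x + c)%R < x) = c)%N by rewrite natr_Zp.
(* As numbers, x + c mod q+2 is x + c - (q+2)[x + c mod q+2 < x]; the residues
   x + c and x have the same sum over x. *)
apply/eqP; rewrite -(eqn_pmul2l (ltn0Sn q.+1)).
rewrite -(eqn_add2r (\sum_(x : G) (x + c)%R)); apply/eqP.
rewrite [in RHS](reindex_inj (addIr (- c))).
rewrite [in RHS](eq_bigr (fun x : G => x : nat)); last first.
  by move=> x _; rewrite subrK.
rewrite big_distrr -big_split /=.
have -> : (q.+2 * c + \sum_(x : G) x = \sum_(x : G) (c + x))%N.
  by rewrite big_split sum_nat_const card_ord.
apply: eq_bigr => x _.
have := val_addG x c; have := ltn_ord x; have := ltn_ord c.
rewrite [nat_of_ord (x + c)%R]/=; move: (_ %% _)%N => y.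
case: (leqP q.+2 (x + c)); case: (ltnP y x) => /=; lia.
Qed.

Lemma sum_cup_wrap l :
  \sum_(s : G) cup_wrap even_cocycle [seq x + s | x <- l] = odd_cocycle l.
Proof.
case: l => [|a [|b l]]; [exact: big1 | exact: big1 |].
transitivity (\sum_(s : G) wrap (a + s) (b + s) * even_cocycle (b :: l)).
  by apply: eq_bigr => s _; rewrite -(even_cocycle_shift s (b :: l)).
by rewrite -big_distrl sum_wrap.
Qed.

Lemma carry_neq a b c : carry a b c != 0 -> (a != b) && (b != c).
Proof.
apply: contraNT; rewrite negb_and !negbK /carry.
have wrapxx x : wrap x x = 0 by rewrite /wrap ltnn.
by case/orP=> /eqP->; rewrite wrapxx; apply/eqP; ring.
Qed.

Lemma even_cocycle_neq a l :
  even_cocycle (a :: l) != 0 -> path (fun x y => x != y) a l.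
Proof.
have [n] := ubnP (size l); elim: n a l => // n IH a [|b [|c l]] //.
move=> szl H; have : carry a b c * even_cocycle (c :: l) != 0 by [].
have [->|/carry_neq/andP[ab bc]] := eqVneq (carry a b c) 0.
  by rewrite mul0r eqxx.
have [->|Y0] := eqVneq (even_cocycle (c :: l)) 0.
  by rewrite mulr0 eqxx.
move=> _; rewrite /= ab bc /=; apply: IH => //.
by move: szl => /=; lia.
Qed.

(** The cocycles are normalised: they vanish on degenerate simplices. *)
Lemma cocycle_neq a l : cocycle (a :: l) != 0 -> path (fun x y => x != y) a l.
Proof.
rewrite /cocycle; case: ifP => _; first exact: even_cocycle_neq.
case: l => [|b l] //= H; have : (b - a) * even_cocycle (b :: l) != 0 by [].
have [->|ab] := eqVneq a b; first by rewrite subrr mul0r eqxx.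
have [->|/even_cocycle_neq //] := eqVneq (even_cocycle (b :: l)) 0.
by rewrite mulr0 eqxx.
Qed.

End Cocycles.

(** * Equivariant signs change along some maximal flag *)

Section SignChanges.
Variables (q : nat) (E : eqType).
Notation G := 'I_q.+2.
Notation signed := (seq (E * G)).
Variable e : signed -> G.

(** Each cocycle is the coboundary of a cup product with [wrap] or with the
    identity; by [pairing_coboundary] its value is that of the norm, resp. of
    the shift difference, of this product on the chain one dimension lower,
    where it becomes the previous cocycle. The value 1 thus descends to a
    single vertex. *)
Lemma pairing_cocycle (v : E) (u : seq E) :
  (forall a X, supported (v :: u) X -> e (rotate a X) = e X + a) ->
  pairing (v :: u) (fun xs => cocycle (map e xs)) = 1.
Proof.
elim: u v => [|w u IH] v e_rot; first by rewrite /= subr0.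
have e_rot' a X : supported (w :: u) X -> e (rotate a X) = e X + a.
  by move=> sX; apply: e_rot; apply: supported_cons.
have e_flag a xs : flag (w :: u) xs ->
    map e (map (rotate a) xs) = [seq x + a | x <- map e xs].
  case/and3P=> _ _ /allP sup; rewrite -!map_comp; apply/eq_in_map => X Xxs /=.
  exact/e_rot'/sup.
rewrite -[RHS](IH w e_rot').
case odd_u : (odd (size u)).
  (* Odd dimension below: the even cocycle is the coboundary of a product with
     [wrap], and the norm turns [wrap] into the degree 1 cocycle. *)
  transitivity (pairing [:: v, w & u]
    (coboundary (fun xs => cup_wrap (@even_cocycle q) (map e xs)))).
    apply: eq_pairing => xs /and3P[/eqP s _ _].
    rewrite coboundary_map coboundary_cup_wrap ?size_map ?s //=; last first.
      by case: (size u) odd_u.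
    by rewrite /cocycle size_map s /= odd_u.
  rewrite pairing_coboundary; apply: eq_pairing => xs Fxs.
  rewrite /wind [odd _]/= odd_u /=.
  rewrite (eq_bigr (fun a =>
      cup_wrap (@even_cocycle q) [seq x + a | x <- map e xs])).
    rewrite sum_cup_wrap /cocycle size_map.
    by case/and3P: Fxs => /eqP-> _ _; rewrite /= odd_u.
  by move=> a _; rewrite e_flag.
(* Even dimension below: a shift by 1 increases the first vertex by 1. *)
transitivity (pairing [:: v, w & u]
    (coboundary (fun xs => cup0 (@even_cocycle q) (map e xs)))).
  apply: eq_pairing => xs /and3P[/eqP s _ _].
  by rewrite coboundary_map coboundary_cup0 /cocycle size_map s /= odd_u.
rewrite pairing_coboundary; apply: eq_pairing => xs Fxs.
rewrite /wind [odd _]/= odd_u /= e_flag // /cocycle size_map.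
case/and3P: Fxs => /eqP s _ _; rewrite s /= odd_u /=.
case: xs s => [|X xs] // _.
transitivity ((e X + 1) * even_cocycle [seq x + 1 | x <- map e (X :: xs)] -
  e X * even_cocycle (map e (X :: xs))); first by [].
by rewrite even_cocycle_shift; ring.
Qed.

(** An analogue of Tucker's lemma for the group Z/(q+2): without such a flag
    the cocycle would vanish on all flags, and its pairing would be 0 and not
    1. *)
Theorem alternating_flag (v : E) (u : seq E) :
  (forall a X, supported (v :: u) X -> e (rotate a X) = e X + a) ->
  ~ (forall X xs, flag (v :: u) (X :: xs) ->
     ~~ path (fun X Y => e X != e Y) X xs).
Proof.
move=> e_rot no; have := pairing_cocycle e_rot.
rewrite (eq_pairing (g := fun=> 0)).
  by rewrite pairing0 => /eqP; rewrite eq_sym oner_eq0.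
case=> [|X xs] // Fxs; apply/eqP; apply: contraNT (no _ _ Fxs).
move/cocycle_neq; rewrite path_map; exact: sub_path.
Qed.
End SignChanges.

(** * Runs in sign sequences *)

Section Runs.
Variable A : eqType.

Fixpoint changes (a : A) (l : seq A) : nat :=
  if l is b :: l' then (a != b) + changes b l' else 0.

Definition runs (l : seq A) : nat :=
  if l is a :: l' then (changes a l').+1 else 0.

(** Deleting entries cannot create runs, and doing so loses one if it changes
    the first sign: the correction term makes the induction work and is what
    allows the first sign to be used as a label. *)
Lemma runs_subseq a s b t :
  subseq (a :: s) (b :: t) -> (runs (a :: s) + (a != b) <= runs (b :: t))%N.
Proof.
have triangle (x y z : A) : ((x != y) <= (x != z) + (y != z))%N.
  have [->|_] := eqVneq x z; first by rewrite eq_sym.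
  by case: (x != y).
elim: t a s b => [|c t IH] a s b; rewrite [subseq _ _]/=.
  by case: (eqVneq a b) => // _; case: s.
case: (eqVneq a b) => [<-|ab].
  case: s => [|d s]; first by rewrite /=; lia.
  move/IH; have := triangle a d c; rewrite /=; lia.
by move/IH; have := triangle a b c; rewrite /= ab; lia.
Qed.

Variable E : eqType.

(** The elements at which a run of sign [g] starts; [prev] tells whether the
    element before [X] has sign [g]. *)
Fixpoint starts (g : A) (prev : bool) (X : seq (E * A)) : seq E :=
  if X is x :: X' then
    let rest := starts g (x.2 == g) X' in
    if (x.2 == g) && ~~ prev then x.1 :: rest else rest
  else [::].

Lemma starts_subseq g prev X : subseq (starts g prev X) (map fst X).
Proof.
elim: X prev => [|x X IH] prev //=.
case: ifP => _; first by rewrite eqxx.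
exact: subseq_trans (IH _) (subseq_cons _ _).
Qed.

Lemma mem_starts g prev X x : x \in starts g prev X -> (x, g) \in X.
Proof.
elim: X prev => [|[y h] X IH] prev //=.
case: ifP => [/andP[/eqP-> _]|_]; rewrite !inE.
  by case/predU1P => [->|/IH->]; rewrite ?eqxx ?orbT.
by move/IH->; rewrite orbT.
Qed.

Variable key : E -> nat.

(** Two starts of runs of the same sign are separated by an element of another
    sign, which lies in block [i] if both starts do, as blocks are contiguous.
    The last term is the start that may open the block; it is absent if the
    element [y] before [X] has sign [g] and is already in the block. *)
Lemma count_starts_path i g prev y X :
  path (relpre key leq) y (map fst X) ->
  (2 * count (fun x => key x == i) (starts g prev X) <=
   count (fun x => key x == i) (map fst X) + ~~ (prev && (i <= key y)))%N.
Proof.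
elim: X prev y => [|[x h] X IH] prev y //= /andP[yx pX].
have := IH (h == g) x pX.
have [hg|hg] := eqVneq h g; rewrite /=.
  by case: prev; rewrite /=; move: yx; rewrite /=;
    case: (leqP i (key x)); case: (leqP i (key y)); case: eqVneq => /=; lia.
have [xi|xi|xi] := ltngtP (key x) i; last by case: (~~ _) => /=; lia.
  by rewrite (leqNgt i) (leq_ltn_trans yx xi) andbF.
move=> _; have X0 : count (fun x => key x == i) (map fst X) = 0.
  apply/eqP; rewrite -leqn0 leqNgt -has_count; apply/hasPn => z zX.
  have /allP/(_ z zX) : all (relpre key leq x) (map fst X).
    by apply: order_path_min pX => a b c; apply: leq_trans.
  by rewrite /= => xz; rewrite gtn_eqF // (leq_trans xi).
have := leq_count_subseq (fun x => key x == i) (starts_subseq g false X).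
lia.
Qed.

Lemma count_starts i g X :
  sorted (relpre key leq) (map fst X) ->
  (2 * count (fun x => key x == i) (starts g false X) <=
   (count (fun x => key x == i) (map fst X)).+1)%N.
Proof.
case: X => [|x X] // sX; rewrite -[leqRHS]addn1.
by apply: (@count_starts_path i g false x.1 (x :: X)); rewrite /= leqnn.
Qed.

End Runs.

Lemma uniq_fst_inj (E A : eqType) (X : seq (E * A)) x g h :
  uniq (map fst X) -> (x, g) \in X -> (x, h) \in X -> g = h.
Proof.
elim: X => [|[y a] X IH] //= /andP[yX uX].
have notin b : (y, b) \notin X.
  by apply: contra yX => ybX; apply/mapP; exists (y, b).
rewrite !inE => /predU1P[[xy ->]|xgX] /predU1P[[xy' ->]|xhX] //.
- by move: xhX; rewrite xy (negPf (notin h)).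
- by move: xgX; rewrite xy' (negPf (notin g)).
- exact: IH.
Qed.

Lemma sum_starts (A : finType) (E : eqType) (X : seq (E * A)) :
  (\sum_g size (starts g false X) = runs (map snd X))%N.
Proof.
have one (h : A) : (\sum_g (h == g) = 1)%N.
  rewrite (bigD1 h) //= eqxx big1 ?addn0 // => g.
  by rewrite eq_sym; case: eqP.
have H (h : A) (Y : seq (E * A)) :
    (\sum_g size (starts g (h == g) Y) = changes h (map snd Y))%N.
  elim: Y h => [|[y a] Y IH] h; first by rewrite big1.
  rewrite /= -IH.
  have -> : nat_of_bool (h != a) = (\sum_g ((a == g) && (h != g)))%N.
    have [<-|ha] := eqVneq h a; first by rewrite big1 // => g _; case: eqP.
    rewrite -[LHS](one a); apply: eq_bigr => g _.
    by have [<-|] := eqVneq a g; rewrite ?ha.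
  by rewrite -big_split; apply: eq_bigr => g _ /=; case: ifP.
case: X => [|[x a] X]; first by rewrite big1.
rewrite /= -H -add1n -[X in (X + _)%N](one a) -big_split.
by apply: eq_bigr => g _; rewrite /= andbT; case: eqP.
Qed.

(** * Monochromatic families for a prime number of sets *)

Section Families.
Variables (E : finType) (m : nat) (key : E -> 'I_m) (s : 'I_m -> nat).

Definition block (i : 'I_m) : {set E} := [set x | key x == i].

Definition admissible (k : nat) (A : {set E}) : bool :=
  (#|A| == k) && [forall i, #|A :&: block i| <= s i]%N.

(** Boolean, so that its negation can be assumed in a proof by contradiction.
    *)
Definition mono_family (I : finType) (k t : nat) (col : {set E} -> 'I_t)
    (N : {set E}) : bool :=
  [exists c, exists F : {ffun I -> {set E}},
    [forall j, [&& F j \subset N, admissible k (F j) & col (F j) == c]] &&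
    [forall i, forall j, (i != j) ==> [disjoint F i & F j]]].

Lemma mono_familyP (I : finType) k t (col : {set E} -> 'I_t) (N : {set E}) :
  reflect (exists c, exists F : I -> {set E},
    (forall j, [/\ F j \subset N, admissible k (F j) & col (F j) = c]) /\
    (forall i j, i != j -> [disjoint F i & F j]))
  (mono_family I k col N).
Proof.
apply: (iffP existsP) => [[c /existsP[F /andP[/forallP good /forallP dis]]]|].
  exists c, F; split=> [j|i j ij]; first by have /and3P[? ? /eqP] := good j.
  exact: implyP (forallP (dis i) j) ij.
case=> c [F [good dis]]; exists c; apply/existsP; exists (finfun F).
apply/andP; split.
  by apply/forallP => j; rewrite ffunE; have [-> -> ->] := good j; rewrite eqxx.
apply/forallP => i; apply/forallP => j; apply/implyP => ij.
by rewrite !ffunE dis.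
Qed.

Lemma mono_family_card (I J : finType) k t (col : {set E} -> 'I_t) N :
  #|I| = #|J| -> mono_family I k col N -> mono_family J k col N.
Proof.
move=> IJ /mono_familyP[c [F [good dis]]]; apply/mono_familyP.
pose h (j : J) : I := enum_val (cast_ord (esym IJ) (enum_rank j)).
have h_inj : injective h.
  by move=> i j /enum_val_inj/cast_ord_inj/enum_rank_inj.
exists c, (F \o h); split=> [j|i j ij] /=; first exact: good.
by apply: dis; rewrite (inj_eq h_inj).
Qed.

Section PrimeUniformity.
Variables (q k t : nat) (col : {set E} -> 'I_t) (N : {set E}).
Hypothesis p_prime : prime q.+2.
Hypothesis N_bound : forall i, (#|N :&: block i| <= 2 * s i)%N.
Notation G := 'I_q.+2.
Notation signed := (seq (E * G)).

Definition sign_class (g : G) (X : signed) : {set E} := [set x | (x, g) \in X].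

Definition fibre (X : signed) (c : 'I_t) : {set G} :=
  [set g | [exists A : {set E},
     [&& A \subset sign_class g X, admissible k.+1 A & col A == c]]].

(** The average of a nonempty subset of Z/p shifts with it, provided that the
    size of the subset is prime to [p]; the choice of the colour by [pick]
    depends only on which fibres are empty, hence is invariant under shifts
    and constant among vectors with the same fibres. *)
Definition sign (X : signed) : G :=
  if [pick c | fibre X c != set0] is Some c
  then (\sum_(g in fibre X c) g) / #|fibre X c|%:R
  else head 0 (map snd X).

(** The number of runs is at most [q.+2 * k] if all fibres are empty, so that
    the second regime starts above the first one. *)
Definition rank (X : signed) : nat :=
  if [exists c, fibre X c != set0]
  then (q.+2 * k + \sum_c #|fibre X c|)%N
  else runs (map snd X).

Definition ground_seq : seq E := sort (relpre key leq) (enum N).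

Lemma supported_facts (X : signed) : supported ground_seq X ->
  [/\ uniq (map fst X), sorted (relpre key leq) (map fst X) &
      {subset map fst X <= N}].
Proof.
case/andP=> _ sub; split.
- by apply: subseq_uniq sub _; rewrite sort_uniq enum_uniq.
- apply: (subseq_sorted _ sub); first by move=> a b c; apply: leq_trans.
  by apply: sort_sorted => a b; apply: leq_total.
- by move=> x /(mem_subseq sub); rewrite mem_sort mem_enum.
Qed.

Lemma fibre_subseq X Y c : subseq X Y -> fibre X c \subset fibre Y c.
Proof.
move=> sXY; apply/subsetP => g; rewrite !inE => /existsP[A /and3P[sA aA cA]].
apply/existsP; exists A; rewrite aA cA (subset_trans sA) //.
by apply/subsetP => x; rewrite !inE; apply: mem_subseq.
Qed.

(** Distinct sign classes of a signed vector are disjoint: a full fibre is a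
    monochromatic family. *)
Lemma fibre_neqT X c :
  ~~ mono_family G k.+1 col N -> supported ground_seq X -> fibre X c != setT.
Proof.
move=> no sX; apply: contra no => /eqP full; apply/mono_familyP; exists c.
have Aex (g : G) : exists A : {set E},
    [&& A \subset sign_class g X, admissible k.+1 A & col A == c].
  by have := in_setT g; rewrite -full inE => /existsP.
have [F FP] := fin_all_exists Aex; have [uX _ subN] := supported_facts sX.
exists F; split=> [g|g h gh].
  have /and3P[sF -> /eqP->] := FP g; split=> //.
  apply/subsetP => x /(subsetP sF); rewrite inE => xg.
  by apply: subN; apply/mapP; exists (x, g).
rewrite -setI_eq0; apply/eqP/setP => x; rewrite in_set0 inE.
apply/negP => /andP[xg xh].
have /and3P[/subsetP/(_ x xg) + _ _] := FP g; rewrite inE => Xg.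
have /and3P[/subsetP/(_ x xh) + _ _] := FP h; rewrite inE => Xh.
by move: gh; rewrite (uniq_fst_inj uX Xg Xh) eqxx.
Qed.

Lemma card_fibre X c :
    ~~ mono_family G k.+1 col N -> supported ground_seq X ->
  (#|fibre X c| < q.+2)%N.
Proof.
move=> no sX; have : fibre X c \proper setT by rewrite properT fibre_neqT.
by move/proper_card; rewrite cardsT card_ord.
Qed.

Lemma mem_sign_class g a X x :
  (x \in sign_class g (rotate a X)) = (x \in sign_class (g - a) X).
Proof.
rewrite !inE; apply/mapP/idP => [[[y h] yX [-> ->]]|xX]; first by rewrite addrK.
by exists (x, g - a); rewrite //= subrK.
Qed.

Lemma fibre_rotate a X c : fibre (rotate a X) c = [set g + a | g in fibre X c].
Proof.
apply/setP => g; apply/idP/imsetP.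
  rewrite inE => /existsP[A /and3P[sA aA cA]].
  exists (g - a); last by rewrite subrK.
  rewrite inE; apply/existsP; exists A; rewrite aA cA !andbT.
  by apply/subsetP => x /(subsetP sA); rewrite mem_sign_class.
case=> h; rewrite !inE => /existsP[A /and3P[sA aA cA]] ->.
apply/existsP; exists A; rewrite aA cA !andbT.
by apply/subsetP => x /(subsetP sA); rewrite mem_sign_class addrK.
Qed.

(** Primality is used here: a nonempty proper subset of Z/p has size prime to
    [p]. *)
Lemma sign_rotate a X :
    ~~ mono_family G k.+1 col N -> supported ground_seq X ->
  sign (rotate a X) = sign X + a.
Proof.
move=> no sX; rewrite /sign.
have card_rot c : #|fibre (rotate a X) c| = #|fibre X c|.
  by rewrite fibre_rotate card_imset //; apply: addIr.
rewrite (@eq_pick _ _ (fun c => fibre X c != set0)); last first.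
  by move=> c /=; rewrite -!card_gt0 card_rot.
case: pickP => [c Xc|_]; last first.
  by case: X sX {card_rot} => [|[x g] X] //; case/andP.
rewrite card_rot fibre_rotate big_imset /=; last by move=> ? ? _ _; apply: addIr.
rewrite big_split /= sumr_const mulrDl -[a *+ _]mulr_natr mulrK //.
have u := @unitZpE q.+2 #|fibre X c| isT; rewrite u prime_coprime //.
by rewrite gtnNdvd ?card_gt0 ?card_fibre.
Qed.

(** With more runs, some sign starts more than [k] of them, and [k.+1] of
    these starting points form an admissible set: by [count_starts] they fill
    at most half of the block, rounded up, and the block has at most [2 * s i]
    elements in [N]. *)
Lemma runs_bound X :
    supported ground_seq X -> ~~ [exists c, fibre X c != set0] ->
  (runs (map snd X) <= q.+2 * k)%N.
Proof.
move=> sX; apply: contraR; rewrite -ltnNge -sum_starts => many.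
have [uX ordX subN] := supported_facts sX.
have [g kg] : exists g : G, (k < size (starts g false X))%N.
  apply/existsP; apply: contraTT many; rewrite negb_exists -leqNgt => /forallP few.
  rewrite -[q.+2 in leqRHS]card_ord -sum_nat_const; apply: leq_sum => g _.
  by rewrite leqNgt.
set A := [set x in take k.+1 (starts g false X)].
have uS : uniq (starts g false X) := subseq_uniq (starts_subseq _ _ _) uX.
have card_filter (l : seq E) i : uniq l ->
    #|[set x in l] :&: block i| = count (fun x => key x == i :> nat) l.
  move=> ul; rewrite -size_filter -(card_uniqP _) ?filter_uniq //.
  by apply: eq_card => x; rewrite !inE mem_filter andbC.
apply/existsP; exists (col A); apply/set0Pn; exists g; rewrite inE.
apply/existsP; exists A; rewrite eqxx andbT; apply/andP; split.
  by apply/subsetP => x; rewrite !inE => /mem_take/mem_starts.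
apply/andP; split.
  by rewrite cardsE (card_uniqP _) ?take_uniq // size_takel.
apply/forallP => i; rewrite card_filter ?take_uniq //.
apply: leq_trans (leq_count_subseq _ (take_subseq _ _)) _.
have blockX : (#|[set x in map fst X] :&: block i| <= 2 * s i)%N.
  apply: leq_trans (N_bound i).
  by apply/subset_leq_card/setSI/subsetP => x; rewrite inE; apply: subN.
rewrite card_filter // -ltnS in blockX.
set c := count _ _.
have : (2 * c <= (2 * s i).+1)%N := leq_trans (count_starts i g ordX) blockX.
lia.
Qed.

Lemma rank_gt0 X : supported ground_seq X -> (0 < rank X)%N.
Proof.
rewrite /rank => sX; case: existsP => [[c Xc]|_].
  by rewrite (bigD1 c) //= !addn_gt0 card_gt0 Xc !orbT.
by case: X sX => [|x X] //; case/andP.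
Qed.

Lemma rank_bound X :
    ~~ mono_family G k.+1 col N -> supported ground_seq X ->
  (rank X <= q.+2 * k + t * q.+1)%N.
Proof.
move=> no sX; rewrite /rank; case: ifPn => [_|/(runs_bound sX) le_runs]; last first.
  by rewrite (leq_trans le_runs) ?leq_addr.
rewrite leq_add2l -[t in leqRHS]card_ord -sum_nat_const; apply: leq_sum => c _.
by rewrite -ltnS card_fibre.
Qed.

(** Both regimes are monotone. At equal rank, two vectors have the same
    fibres, or the same first sign by [runs_subseq]. *)
Lemma rank_subseq X Y : supported ground_seq X -> supported ground_seq Y ->
  subseq X Y -> sign X != sign Y -> (rank X < rank Y)%N.
Proof.
move=> sX sY sXY; rewrite /rank.
case: (boolP [exists c, fibre X c != set0]) => [exX|noX].
  have -> : [exists c, fibre Y c != set0].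
    case/existsP: exX => c; rewrite -card_gt0 => Xc; apply/existsP; exists c.
    by rewrite -card_gt0 (leq_trans Xc) // subset_leq_card // fibre_subseq.
  apply: contraNT; rewrite ltn_add2l -leqNgt => YX.
  have fib_eq : fibre X =1 fibre Y.
    move=> c; apply/eqP; rewrite eqEcard fibre_subseq //=.
    move: YX; rewrite (bigD1 c) //= [leqRHS](bigD1 c) //=.
    set u := (\sum_(i | _) _)%N; set v := (\sum_(i | _) _)%N.
    have : (v <= u)%N by apply: leq_sum => d _; rewrite subset_leq_card ?fibre_subseq.
    by lia.
  rewrite /sign (@eq_pick _ _ (fun c => fibre Y c != set0)).
    case: pickP => [c _|no]; first by rewrite fib_eq.
    by case/existsP: exX => c; rewrite fib_eq no.
  by move=> c /=; rewrite fib_eq.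
case: ifPn => [/existsP[c Yc] _|noY].
  apply: leq_ltn_trans (runs_bound sX noX) _; rewrite -addn1 leq_add2l.
  by rewrite (bigD1 c) //= addn_gt0 card_gt0 Yc.
have head_sign Z : ~~ [exists c, fibre Z c != set0] -> sign Z = head 0 (map snd Z).
  move=> noZ; rewrite /sign; case: pickP => // c Zc.
  by case/negP: noZ; apply/existsP; exists c.
rewrite !head_sign //.
case: X Y sX sY sXY {noX noY} => [|x X] [|y Y] // _ _ sXY ne.
have := runs_subseq (map_subseq snd sXY); rewrite [head _ _]/= in ne.
by rewrite /= in ne *; rewrite ne addn1.
Qed.

(** Along an alternating flag the rank is at least 1 and grows at each step,
    so that it reaches #|N|, beyond its upper bound. *)
Lemma prime_mono_family :
  (q.+2 * k + t * q.+1 < #|N|)%N -> mono_family G k.+1 col N.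
Proof.
move=> big; apply: contraT => no.
have sz : size ground_seq = #|N| by rewrite size_sort -cardE.
case E_ord : ground_seq => [|v u]; first by rewrite -sz E_ord in big.
case: (@alternating_flag q E sign v u).
  by move=> a X; rewrite -E_ord; apply: sign_rotate.
move=> X xs; rewrite -E_ord => /and3P[/eqP szX /andP[_ pX] sup].
apply: contraL big => alt; rewrite -leqNgt -sz -szX.
have grow : (rank X + size xs <= rank (last X xs))%N.
  elim: xs X pX sup alt {szX} => [|Y xs IH] X; first by rewrite addn0.
  move=> /= /andP[XY pY] /and3P[sX sY sup] /andP[ne alt].
  have := rank_subseq sX sY XY ne; have := IH Y pY _ alt.
  by rewrite /= sY => /(_ sup); lia.
have lastS : supported ground_seq (last X xs) by apply: (allP sup); apply: mem_last.
have sX : supported ground_seq X by case/andP: sup.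
apply: leq_trans (rank_bound no lastS); apply: leq_trans grow.
by rewrite [leqLHS]/= -[leqLHS]add1n leq_add2r rank_gt0.
Qed.
End PrimeUniformity.
End Families.

Local Close Scope ring_scope.

(** * Monochromatic families for any number of sets *)

(** Product induction. The constants fit: with [n' = a * k + t * a.-1], the
    sets of size [n'.+1] are large enough for [a], and [b * n' + t * b.-1]
    equals [a * b * k + t * (a * b).-1]. The outer family is sought with a
    single block, which constrains nothing; the sets inside its members obey
    the block bounds. The induction cannot start at [r = 1], where a single
    block of [2 * s i] elements would contain no admissible set of more than
    [s i] elements. *)
Lemma mono_family_ord (E : finType) r (m : nat) (key : E -> 'I_m)
    (s : 'I_m -> nat) k t (col : {set E} -> 'I_t) (N : {set E}) :
  (2 <= r)%N -> (forall i, (#|N :&: block key i| <= 2 * s i)%N) ->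
  (r * k + t * r.-1 < #|N|)%N -> mono_family key s 'I_r k.+1 col N.
Proof.
elim/ltn_ind: r m key s k t col N => r IH m key s k t col N r_ge2 N_bound big.
have [p_r|r_comp] := boolP (prime r).
  by case: r p_r {IH r_ge2} big => [|[|q]] // p_r; apply: prime_mono_family.
have [a [b [a_ge2 b_ge2 r_ab]]] : exists a b, [/\ 2 <= a, 2 <= b & r = a * b]%N.
  case/primePn: r_comp => [|[d /andP[d_gt1 d_lt_r] d_r]]; first by lia.
  exists d, (r %/ d)%N; split=> //; last by rewrite mulnC divnK.
  by move: d_lt_r; rewrite -{1}(divnK d_r); nia.
have [a_lt b_lt] : (a < r)%N /\ (b < r)%N by nia.
set n' := (a * k + t * a.-1)%N.
have big_b : (b * n' + t * b.-1 < #|N|)%N.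
  apply: leq_ltn_trans big; rewrite r_ab /n'.
  by case: a b a_ge2 b_ge2 {r_ab a_lt b_lt n'} => [|a] [|b] //= _ _; nia.
have inner (M : {set E}) : exists c : 'I_t, M \subset N -> #|M| = n'.+1 ->
    exists F : 'I_a -> {set E},
    (forall j, [/\ F j \subset M, admissible key s k.+1 (F j) & col (F j) = c]) /\
    (forall i j, i != j -> [disjoint F i & F j]).
  have [/andP[MN /eqP cM]|no] := boolP ((M \subset N) && (#|M| == n'.+1)).
    have /mono_familyP[c cF] : mono_family key s 'I_a k.+1 col M.
      apply: IH => // [i|]; last by rewrite cM.
      by apply: leq_trans (N_bound i); apply/subset_leq_card/setSI.
    by exists c.
  exists (col set0) => MN cM; by rewrite MN cM eqxx in no.
have [col2 col2P] := fin_all_exists inner.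
have : mono_family (fun=> ord0 : 'I_1) (fun=> #|E|) 'I_b n'.+1 col2 N.
  apply: IH => // i; rewrite mul2n -addnn.
  exact: leq_trans (max_card _) (leq_addr _ _).
case/mono_familyP => c [F2 [good2 dis2]].
have inner2 (j : 'I_b) : exists F : 'I_a -> {set E},
    (forall i, [/\ F i \subset F2 j, admissible key s k.+1 (F i) & col (F i) = c]) /\
    (forall i i', i != i' -> [disjoint F i & F i']).
  by have [F2N /andP[/eqP cF2 _] <-] := good2 j; apply: col2P.
have [F FP] := fin_all_exists inner2.
apply: (@mono_family_card _ _ _ _ ('I_b * 'I_a)%type).
  by rewrite card_prod !card_ord r_ab mulnC.
apply/mono_familyP; exists c, (fun x => F x.1 x.2); split=> [[j i]|[j i] [j' i']] /=.
  have [[/(_ i)[sub adm cF] _] [F2N _ _]] := (FP j, good2 j).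
  by split=> //; apply: subset_trans F2N.
have [<-|jj' _] := eqVneq j j'.
  by rewrite xpair_eqE eqxx /=; apply: (FP j).2.
have [[/(_ i)[sub _ _] _] [/(_ i')[sub' _ _] _]] := (FP j, FP j').
exact: disjointWl sub (disjointWr sub' (dis2 _ _ jj')).
Qed.

(** Double counting: disjointness puts each point of [D] in at most one of the
    sets. *)
Lemma sum_card_setI (V E : finType) (f : V -> {set E}) (S : {set V}) (D : {set E}) :
  {in S &, forall u v, u != v -> [disjoint f u & f v]} ->
  (\sum_(v in S) #|f v :&: D| <= #|D|)%N.
Proof.
move=> dis.
rewrite (eq_bigr (fun v => \sum_(x in D) (x \in f v))%N); last first.
  move=> v _; rewrite -sum1_card big_mkcond [RHS]big_mkcond.
  by apply: eq_bigr => x _; rewrite inE andbC; case: (x \in D) => //=;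
    case: (x \in f v).
rewrite exchange_big -sum1_card; apply: leq_sum => x _.
rewrite -big_mkcondr sum1dep_card; apply/card_le1_eqP => u v.
rewrite !inE => /andP[uS xu] /andP[vS xv]; apply/eqP.
apply: contraTT xv; rewrite eq_sym => uv.
by rewrite (disjointFr (dis _ _ uS vS uv) xu).
Qed.

Lemma card_quotient_class n d c : (0 < d)%N ->
  (#|[set x : 'I_n | x %/ d == c]| <= d)%N.
Proof.
case: d => // d _; rewrite -[leqRHS]card_ord.
rewrite -(@card_in_imset _ _ (fun x : 'I_n => inord (x %% d.+1) : 'I_d.+1)).
  exact: max_card.
move=> x y; rewrite !inE => /eqP xc /eqP yc /(congr1 val).
rewrite /= !inordK ?ltn_mod // => xy; apply: val_inj.
by rewrite /= (divn_eq x d.+1) (divn_eq y d.+1) xc yc xy.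
Qed.

Lemma card_tail n a : #|[set x : 'I_n | a <= x]%N| = (n - a)%N.
Proof.
rewrite -sum1_card -[RHS]muln1 -sum_nat_const_nat big_geq_mkord.
by apply: eq_bigl => x; rewrite inE.
Qed.

(** * The chromatic number of multiple Kneser hypergraphs *)

Section MultipleKneserChromatic.
Variables (n m r k : nat) (P : 'I_m -> {set 'I_n}) (s : 'I_m -> nat).
Hypothesis r_ge2 : (2 <= r)%N.

Lemma KG_edge_disjoint (e : {set kneser_vertex P s k.+1}) :
  e \in edges (KG r P s k.+1) ->
  #|e| = r /\ {in e &, forall u v : kneser_vertex P s k.+1,
                 u != v -> [disjoint val u & val v]}.
Proof.
rewrite inE => /andP[/eqP ce /trivIsetP tI]; split=> // u v ue ve uv.
by apply: tI; rewrite ?imset_f // (inj_eq val_inj).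
Qed.

(** The blocks are the classes of [x %/ r.-1] for the first [t.-1] quotients.
    *)
Lemma KG_colorable t : (0 < t)%N -> (n <= t * r.-1 + r * k)%N ->
  colorable (KG r P s k.+1) t.
Proof.
case: t => // t _ n_le; set d := r.-1 in n_le *.
have d_gt0 : (0 < d)%N by rewrite /d; lia.
pose hits (A : {set 'I_n}) (c : 'I_t.+1) :=
  (c < t)%N && [exists x in A, x %/ d == c].
pose c (v : kneser_vertex P s k.+1) := odflt ord_max [pick c | hits (val v) c].
apply/existsP; exists (finfun c); apply/forall_inP => e /KG_edge_disjoint[ce dis].
apply/negP => /forall_inP mono.
have [v0 v0e] : exists v, v \in e by apply/set0Pn; rewrite -card_gt0 ce; lia.
have col v : v \in e -> c v = c v0.
  by move=> ve; have /forall_inP/(_ _ v0e) := mono v ve; rewrite !ffunE => /eqP.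
have few a (D : {set 'I_n}) :
    (forall v, v \in e -> a <= #|val v :&: D|)%N -> (r * a <= #|D|)%N.
  move=> aD; apply: leq_trans (sum_card_setI D dis).
  by rewrite -ce -sum_nat_const leq_sum.
have [hit|nohit] := boolP (hits (val v0) (c v0)).
  have := few 1 [set x : 'I_n | x %/ d == c v0]; rewrite muln1 => /(_ _)/leq_trans.
  move=> /(_ _ _ (card_quotient_class _ _ d_gt0)).
  suff H v : v \in e -> (0 < #|val v :&: [set x : 'I_n | x %/ d == c v0]|)%N.
    by move/(_ H); rewrite /d; lia.
  move=> ve; have : hits (val v) (c v0).
    move: hit; rewrite -(col v ve) /c; case: pickP => [b //|_].
    by rewrite /hits /= ltnn.
  case/andP=> _ /existsP[x /andP[xv xc]].
  by rewrite card_gt0; apply/set0Pn; exists x; rewrite !inE xv.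
have nohits v : v \in e -> forall b, ~~ hits (val v) b.
  move=> ve b; apply/negP => vb; case/negP: nohit.
  move: (col v ve); rewrite /c; case: pickP => [b' vb'|/(_ b)]; last by rewrite vb.
  case: pickP => [b0 v0b0 //|no] /= b'max.
  by move: vb'; rewrite b'max /hits ltnn.
have := few k.+1 [set x : 'I_n | t * d <= x]%N; rewrite card_tail.
suff H v : v \in e -> (k < #|val v :&: [set x : 'I_n | t * d <= x]%N|)%N.
  by move=> /(_ H); move: n_le; rewrite /d; nia.
move=> ve; have /and3P[_ /eqP cv _] := valP v.
rewrite (setIidPl _) ?cv //; apply/subsetP => x xv; rewrite inE.
rewrite leqNgt; apply/negP => x_lt.
have xt : (x %/ d < t)%N by rewrite ltn_divLR.
case/negP: (nohits v ve (Ordinal (ltnW xt : (x %/ d < t.+1)%N))).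
by rewrite /hits /= xt; apply/existsP; exists x; rewrite xv /=.
Qed.

Hypothesis partP : ordered_partition P.
Hypothesis s_bounds : forall i, (s i <= #|P i| <= 2 * s i)%N.
Hypothesis k_le : (k < \sum_(i < m) s i)%N.

Lemma partition_key : exists key : 'I_n -> 'I_m, forall i, P i = block key i.
Proof.
have [/injectiveP P_inj /and3P[/eqP cov tI _]] := andP partP.
have ex x : exists i, x \in P i.
  have : x \in cover [set P i | i : 'I_m] by rewrite cov inE.
  by case/bigcupP => _ /imsetP[i _ ->]; exists i.
have [key keyP] := fin_all_exists ex; exists key => i.
apply/setP => x; rewrite inE; apply/idP/eqP => [xi|<- //].
apply/eqP; apply: contraTT xi => ki.
have dis : [disjoint P (key x) & P i].
  by apply: (trivIsetP tI); rewrite ?imset_f // (inj_eq P_inj).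
by rewrite (disjointFr dis).
Qed.

Lemma subset_of_card (T : finType) (A : {set T}) a : (a <= #|A|)%N ->
  exists2 B : {set T}, B \subset A & #|B| = a.
Proof.
move=> aA; exists [set x in take a (enum A)].
  by apply/subsetP => x; rewrite inE => /mem_take; rewrite mem_enum.
by rewrite cardsE (card_uniqP _) ?take_uniq ?enum_uniq // size_takel // -cardE.
Qed.

Lemma kneser_vertexE key A : (forall i, P i = block key i) ->
  kneser_vertex_pred P s k.+1 A = admissible key s k.+1 A.
Proof.
move=> PE; rewrite /kneser_vertex_pred /admissible.
have -> : A \subset \bigcup_i P i.
  by apply/subsetP => x _; apply/bigcupP; exists (key x); rewrite // PE inE.
by rewrite andTb; congr (_ && _); apply: eq_forallb => i; rewrite PE.
Qed.

(** The union of subsets of size [s i] of the blocks is large enough. A vertex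
    is needed to exclude the empty set of colours, and to serve as a default
    value. *)
Lemma kneser_vertex_exists : exists A, kneser_vertex_pred P s k.+1 A.
Proof.
have [key PE] := partition_key.
have ex i : exists B : {set 'I_n}, B \subset P i /\ #|B| = s i.
  have /andP[sP _] := s_bounds i.
  by have [B ? ?] := subset_of_card sP; exists B.
have [B BP] := fin_all_exists ex.
pose U := [set x | x \in B (key x)].
have UB i : U :&: block key i = B i.
  apply/setP => x; rewrite !inE; apply/andP/idP => [[+ /eqP<-] //|xB].
  have : x \in P i by apply: (subsetP (BP i).1).
  by rewrite PE inE => /eqP->.
have cardU : (k < #|U|)%N.
  apply: leq_trans k_le _; rewrite -sum1_card (partition_big key predT) //=.
  apply: leq_sum => i _; rewrite -(BP i).2 -UB -sum1_card.
  by rewrite leq_eqVlt; apply/orP; left; apply/eqP/eq_bigl => x; rewrite !inE.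
have [A AU cA] := subset_of_card cardU; exists A.
rewrite (kneser_vertexE _ PE) /admissible cA eqxx; apply/forallP => i.
by rewrite -(BP i).2 -UB; apply/subset_leq_card/setSI.
Qed.

Lemma KG_not_colorable t : (t * r.-1 + r * k < n)%N ->
  ~~ colorable (KG r P s k.+1) t.
Proof.
move=> n_gt; apply/negP => /existsP[c /forall_inP cP].
have [key PE] := partition_key; have [A0 A0P] := kneser_vertex_exists.
pose v0 : kneser_vertex P s k.+1 := Sub A0 A0P.
have : mono_family key s 'I_r k.+1 (fun A => c (insubd v0 A)) setT.
  apply: mono_family_ord => // [i|]; last by rewrite cardsT card_ord addnC.
  by rewrite setTI -PE; case/andP: (s_bounds i).
case/mono_familyP => b [F [good dis]].
pose f j : kneser_vertex P s k.+1 := insubd v0 (F j).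
have fE j : val (f j) = F j.
  by rewrite insubdK // -topredE /= (kneser_vertexE _ PE); case: (good j).
have f_inj : injective f.
  move=> i j /(congr1 val); rewrite !fE => Fij; apply/eqP.
  apply: contraT => ij; have := dis _ _ ij; rewrite Fij -setI_eq0 setIid.
  have [_ /andP[/eqP cF _] _] := good j.
  by rewrite -cards_eq0 cF.
have edge_f : [set f j | j : 'I_r] \in edges (KG r P s k.+1).
  rewrite inE card_imset // card_ord eqxx /=; apply/trivIsetP.
  move=> _ _ /imsetP[_ /imsetP[i _ ->] ->] /imsetP[_ /imsetP[j _ ->] ->].
  by rewrite !fE => Fij; apply: dis; apply: contraNneq Fij => ->.
case/negP: (cP _ edge_f); apply/forall_inP => _ /imsetP[i _ ->].
apply/forall_inP => _ /imsetP[j _ ->].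
by have [[_ _ ->] [_ _ ->]] := (good i, good j).
Qed.

Lemma KG_chromatic_number_bounds (n_large : (r * k < n)%N) :
  let chi := chromatic_number (KG r P s k.+1) in
  (0 < chi)%N /\ (chi.-1 * r.-1 + r * k < n <= chi * r.-1 + r * k)%N.
Proof.
have : colorable (KG r P s k.+1) n by apply: KG_colorable; [lia | nia].
move=> /chromatic_numberP; set chi := chromatic_number _ => -[col_chi chi_min] /=.
have le_n : (n <= chi * r.-1 + r * k)%N.
  by rewrite leqNgt; apply: contraL col_chi; apply: KG_not_colorable.
have chi_gt0 : (0 < chi)%N by case: (chi) le_n => //; lia.
split=> //; rewrite le_n andbT ltnNge; apply/negP => le_n'.
case: (posnP chi.-1) => [chi0|chi1_gt0].
  by move: le_n'; rewrite chi0; lia.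
by have := chi_min _ (KG_colorable chi1_gt0 le_n'); lia.
Qed.

End MultipleKneserChromatic.

Theorem theorem3 (k r n m : nat) (P : 'I_m -> {set 'I_n}) (s : 'I_m -> nat)
  (k_gt0 : (0 < k)%N) (r_ge2 : (2 <= r)%N) (n_gt0 : (0 < n)%N)
  (m_gt0 : (0 < m)%N)
  (partP : ordered_partition P)
  (s_gt0 : forall i : 'I_m, (0 < s i)%N)
  (s_bounds : forall i : 'I_m, (s i <= #|P i| <= 2 * s i)%N)
  (k_le : (k <= \sum_(i < m) s i)%N)
  (n_large : (r * (k - 1) < n)%N) :
  Posz (chromatic_number (KG r P s k)) =
  Num.ceil ((n%:R - r%:R * (k%:R - 1)) / (r%:R - 1) : rat)%R.
Proof.
case: k k_gt0 k_le n_large => // k _ k_le; rewrite subn1 /= => n_large.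
have [chi_gt0] := KG_chromatic_number_bounds r_ge2 partP s_bounds k_le n_large.
set chi := chromatic_number _ in chi_gt0 *; case: chi chi_gt0 => // chi _.
case: r r_ge2 {n_large} => [|[|r]] // _ /=.
rewrite -(ltr_nat rat) -(ler_nat rat) !natrD !natrM => /andP[lo hi].
apply/esym/eqP; rewrite ceil_eq intrB !pmulrn.
have d_gt0 : (0 < r.+2%:R - 1 :> rat)%R by rewrite subr_gt0 ltr1n.
rewrite ltr_pdivlMr // ler_pdivrMr //.
move: lo hi; rewrite -!natr1 => lo hi.
apply/andP; split; lra.
Qed.
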